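(* For each integer $k\ge 6$, there exist infinitely many pairwise non-isomorphic finite simple toroidal graphs $G$ such that $G$ contains no cycle of length $\ell$ for any $\ell$ with $6\le \ell\le k$, and $G$ has chromatic number exactly $5$.
   Context: A graph is toroidal if it can be embedded on the torus. ''Contains no cycle of length $\ell$'' means $G$ has no subgraph that is a cycle on $\ell$ vertices. *)

(* Defs.v *)
From HB Require Import structures.
From mathcomp Require Import all_boot all_order all_algebra.
From mathcomp Require Import all_classical all_reals all_analysis.
Set Implicit Arguments.
Unset Strict Implicit.
Unset Printing Implicit Defensive.
Import Order.TTheory GRing.Theory Num.Theory.
Import numFieldNormedType.Exports.
Local Open Scope ring_scope.

Record sgraph := SGraph {
  vertex :> finType;
  adj : rel vertex;
  adj_sym : symmetric adj;
  adj_irrefl : irreflexive adj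
}.

Definition edges (G : sgraph) : {set {set G}} :=
  [set [set x; y] | x in G, y in G & adj x y]%SET.

Definition graph_iso (G H : sgraph) : Prop :=
  exists f : G -> H, bijective f /\ forall x y, adj (f x) (f y) = adj x y.

(* The bound 2 < l is needed because ucycle accepts the empty sequence and,
   since adj is symmetric, the two endpoints of any edge. *)
Definition has_cycle (G : sgraph) (l : nat) : Prop :=
  (2 < l)%N /\ exists s : seq G, size s = l /\ ucycle (@adj G) s.

Definition colorable (G : sgraph) (n : nat) : bool :=
  [exists c : {ffun G -> 'I_n},
    [forall x, forall y, adj x y ==> (c x != c y)]].

Lemma colorable_card (G : sgraph) : exists n, colorable G n.
Proof.
exists #|G|; apply/existsP; exists [ffun x => enum_rank x].
apply/forallP => x; apply/forallP => y; apply/implyP => xy.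
rewrite !ffunE (inj_eq enum_rank_inj).
by apply: contraTneq xy => ->; rewrite adj_irrefl.
Qed.

Definition chromatic_number (G : sgraph) : nat := ex_minn (colorable_card G).

Definition torus (R : realType) : set ((R * R) * (R * R)) :=
  [set p | p.1.1 ^+ 2 + p.1.2 ^+ 2 = 1 /\ p.2.1 ^+ 2 + p.2.2 ^+ 2 = 1]%classic.

Section Embedding.
Local Open Scope classical_set_scope.

(* [g e] parametrizes the arc drawn for the edge e, in either direction; its
   values on sets that are not edges, and outside of [0, 1], are irrelevant.
   Since S is given the subspace topology, continuity into S is continuity
   into T. *)
Definition embedding (R : realType) (T : topologicalType) (S : set T)
    (G : sgraph) (f : G -> T) (g : {set G} -> R -> T) : Prop :=
  [/\ injective f,
      (forall x, S (f x)),
      (forall e, e \in edges G ->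
        [/\ {within `[0, 1], continuous (g e)},
            {in `[0, 1] &, injective (g e)},
            g e @` `[0, 1] `<=` S,
            [set g e 0; g e 1] = f @` [set` e] &
            g e @` `]0, 1[ `&` range f = set0]) &
      (forall e e', e \in edges G -> e' \in edges G -> e != e' ->
        g e @` `]0, 1[ `&` g e' @` `]0, 1[ = set0)].

End Embedding.

Definition toroidal (R : realType) (G : sgraph) : Prop :=
  exists f g, @embedding R ((R * R) * (R * R))%type (@torus R) G f g.

(* Main.v *)
Require Import Defs.
From HB Require Import structures.
From mathcomp Require Import all_boot all_order all_algebra.
From mathcomp Require Import all_classical all_reals all_analysis.
From mathcomp Require Import zify lra.

Set Implicit Arguments.
Unset Strict Implicit.
Unset Printing Implicit Defensive.

Import Order.TTheory GRing.Theory Num.Theory.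
Import numFieldNormedType.Exports.

(** The disjoint union of K5 and n isolated vertices has chromatic number 5 and
    no cycle through more than five vertices.  The square grid Z^2 modulo the
    lattice L = {(a, b) | 5 divides a + 2b} is a drawing of K5 on the torus
    R^2 / L: the vertex i is the class of (i, 0), and the horizontal and vertical
    grid edges join i to i + 1 and to i + 2 modulo 5.  The isolated vertices are
    placed inside a face, at points neither of whose coordinates is an integer. *)

(** * Coordinates on the torus as a quotient of the plane *)

Section TorusCoordinates.
Variable R : realType.
Local Open Scope ring_scope.

Definition circle_pt (x : R) : R * R := (cos (pi *+ 2 * x), sin (pi *+ 2 * x)).

Lemma circle_ptDz (x : R) (m : int) : circle_pt (x + m%:~R) = circle_pt x.
Proof.
have pern (f : R -> R) (n : nat) y : periodic f (pi *+ 2) ->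
    f (pi *+ 2 * (y + n%:R)) = f (pi *+ 2 * y).
  by move=> pf; rewrite mulrDr [_ * n%:R]mulr_natr periodicn.
suff perz (f : R -> R) : periodic f (pi *+ 2) ->
    f (pi *+ 2 * (x + m%:~R)) = f (pi *+ 2 * x).
  by rewrite /circle_pt (perz _ (@cosD2pi R)) (perz _ (@sinD2pi R)).
move=> pf; case: m => n; first exact: pern.
by rewrite NegzE -[LHS](pern f n.+1)// mulrNz subrK.
Qed.

(** The angle difference has cosine 1, and so has [pi *+ 2 * r], where [r] is the fractional part of
    [x - y]. Then [sin (pi * r) = 0]; as the sine is positive on (0, pi), this forces [r = 0]. *)
Lemma circle_pt_eq (x y : R) :
  circle_pt x = circle_pt y -> exists m : int, x - y = m%:~R.
Proof.
move=> [ecos esin]; exists (Num.floor (x - y)).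
have : cos (pi *+ 2 * (x - y)) = 1.
  by rewrite mulrBr cosB ecos esin -!expr2 cos2Dsin2.
have [] := circle_ptDz (x - y) (- Num.floor (x - y)).
move: (floor_itv (x - y)); set m := Num.floor _.
rewrite mulrNz => /andP[m1 m2] <- _.
rewrite intrD in m2.
set r := x - y - m%:~R => cr; apply/eqP; rewrite -subr_eq0 -/r.
have pi0 := pi_gt0 R.
have : sin (pi * r) ^+ 2 = 0.
  by have := cr; rewrite mulrnAl cos_mulr2n cos2sin2; lra.
move/eqP; rewrite sqrf_eq0; apply: contraLR => r0.
have rpos : 0 < r by rewrite lt_neqAle eq_sym r0 /= subr_ge0.
rewrite gt_eqF// sin_gt0_pi// mulr_gt0//= -ltr_pdivlMl// mulVf ?gt_eqF//.
by rewrite /r; lra.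
Qed.

Lemma continuous_circle_pt : continuous circle_pt.
Proof.
move=> x; have cM : {for x, continuous (fun z : R => pi *+ 2 * z)}.
  by apply: continuousM; [exact: cst_continuous|exact: cvg_id].
apply: (@cvg_pair _ _ _ _ (nbhs _) (nbhs _)).
  by apply: continuous_comp cM _; exact: continuous_cos.
by apply: continuous_comp cM _; exact: continuous_sin.
Qed.

(* Coordinates on the torus adapted to the lattice spanned by (1, 2) and
   (2, -1), which consists of the integer points (p, q) with 5 | p + 2 q. *)
Definition torus_pt (a b : R) : (R * R) * (R * R) :=
  (circle_pt ((a + 2 * b) / 5), circle_pt ((2 * a - b) / 5)).

Lemma torus_pt_torus (a b : R) : torus (torus_pt a b).
Proof. by split; rewrite /= cos2Dsin2. Qed.

(** Both circle coordinates agree when (p + 2q)/5 and (2p - q)/5 are integers. The first condition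
    implies the second, because 2p - q = 2(p + 2q) - 5q. *)
Lemma torus_pt_eqP (a b a' b' : R) :
  torus_pt a b = torus_pt a' b' <->
  exists p q : int, [/\ a = a' + p%:~R, b = b' + q%:~R & (5 %| p + 2 * q)%Z].
Proof.
split=> [ab|[p [q [-> -> /dvdzP[m pqm]]]]]; last first.
  have -> : p = m * 5 - 2 * q by lia.
  rewrite /torus_pt -(circle_ptDz ((a' + 2 * b') / 5) m).
  rewrite -(circle_ptDz ((2 * a' - b') / 5) (2 * m - q)).
  by congr (circle_pt _, circle_pt _);
    rewrite !(intrD, intrM, mulrNz, rmorph_nat); lra.
have /circle_pt_eq[m mE] : (torus_pt a b).1 = (torus_pt a' b').1 by rewrite ab.
have /circle_pt_eq[n nE] : (torus_pt a b).2 = (torus_pt a' b').2 by rewrite ab.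
(* The solution of p + 2q = 5m, 2p - q = 5n. *)
exists (m + 2 * n), (2 * m - n); split; last by apply/dvdzP; exists m; lia.
all: rewrite !(intrD, intrM, mulrNz, rmorph_nat) -mE -nE; lra.
Qed.

Lemma continuous_torus_pt (a b : R -> R) :
  continuous a -> continuous b -> continuous (fun t => torus_pt (a t) (b t)).
Proof.
move=> ca cb t; have cst x : {for t, continuous (fun=> x : R)}.
  exact: cst_continuous.
apply: (@cvg_pair _ _ _ _ (nbhs _) (nbhs _)).
  apply: (@continuous_comp _ _ _ (fun t => (a t + 2 * b t) / 5) circle_pt);
    last exact: continuous_circle_pt.
  apply: continuousM (cst _); apply: continuousD (ca _) _.
  exact: continuousM (cst _) (cb _).
apply: (@continuous_comp _ _ _ (fun t => (2 * a t - b t) / 5) circle_pt);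
  last exact: continuous_circle_pt.
apply: continuousM (cst _); apply: continuousB (cb _).
exact: continuousM (cst _) (ca _).
Qed.

End TorusCoordinates.

(** * K5 with isolated vertices: cycles, chromatic number, edges *)

Section PaddedK5.
Variable n : nat.

Definition K5_adj : rel ('I_5 + 'I_n) := fun x y =>
  match x, y with inl i, inl j => i != j | _, _ => false end.

Lemma K5_adj_sym : symmetric K5_adj.
Proof. by case=> [i|i] [j|j] //=; rewrite eq_sym. Qed.

Lemma K5_adj_irrefl : irreflexive K5_adj.
Proof. by case=> [i|i] //=; rewrite eqxx. Qed.

Definition padded_K5 : sgraph := SGraph K5_adj_sym K5_adj_irrefl.

(** Each vertex of a cycle is adjacent to its successor, so it is not isolated; only the five
    vertices of K5 remain. *)
Lemma padded_K5_no_long_cycle l : (5 < l)%N -> ~ has_cycle padded_K5 l.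
Proof.
move=> l5 [_ [s [sl /andP[cs us]]]].
suff ss : {subset s <= codom (inl : 'I_5 -> 'I_5 + 'I_n)}.
  have := uniq_leq_size us ss; rewrite size_codom card_ord sl.
  by rewrite leqNgt l5.
by move=> [i|i] /(next_cycle cs); [rewrite codom_f|].
Qed.

Lemma padded_K5_chromatic_number : chromatic_number padded_K5 = 5%N.
Proof.
apply/eqP; rewrite eqn_leq /chromatic_number; case: ex_minnP => m cm minm.
apply/andP; split.
  apply: minm; apply/existsP.
  exists [ffun x : 'I_5 + 'I_n => if x is inl i then i else ord0].
  apply/forallP => -[i|i]; apply/forallP => -[j|j]; apply/implyP => //=.
  by rewrite !ffunE.
case/existsP: cm => c /forallP cP.
suff /leq_card : injective (fun i : 'I_5 => c (inl i)) by rewrite !card_ord.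
move=> i j cij; apply/eqP; apply: contraT => ij.
by have /forallP/(_ (inl j))/implyP/(_ ij) := cP (inl i); rewrite cij eqxx.
Qed.

(** The ten edges of K5 form two 5-cycles, of steps 1 and 2 modulo 5, drawn horizontally and
    vertically respectively; addition is that of ['I_5]. *)
Definition K5_edge (h : bool) (i : 'I_5) : {set padded_K5} :=
  [set inl i; inl (if h then i + 1 else i + 2)%R]%SET.

Lemma padded_K5_edgeP (e : {set padded_K5}) :
  e \in edges padded_K5 -> exists h i, e = K5_edge h i.
Proof.
case/imset2P => -[i|i] [j|j] _; rewrite inE //= => ij ->.
(* A nonzero residue modulo 5 is 1, 2, -1 or -2. For a negative step the edge is read from its other
   endpoint. *)
have : j \in [:: i + 1; i + 2; i - 1; i - 2]%R.
  by move: i j ij => [[|[|[|[|[|?]]]]] //= ?] [[|[|[|[|[|?]]]]] //= ?].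
rewrite !inE => /or4P[] /eqP->;
  [exists true, i | exists false, i
  | exists true, (i - 1)%R | exists false, (i - 2)%R];
  by rewrite /K5_edge ?subrK// finset.setUC.
Qed.

End PaddedK5.

Lemma card_padded_K5 n : #|padded_K5 n| = (5 + n)%N.
Proof. by rewrite card_sum !card_ord. Qed.

(** * The grid drawing and its verification *)

Section Drawing.
Variables (R : realType) (n : nat).
Local Open Scope ring_scope.

(** The shift by 2 keeps the second coordinate of an isolated vertex strictly between 0 and 1. *)
Definition vertex_pt (x : padded_K5 n) : (R * R) * (R * R) :=
  match x with
  | inl i => torus_pt i%:R 0
  | inr j => torus_pt (1 / 2) j.+2%:R^-1
  end.

Definition arc (h : bool) (i : 'I_5) (t : R) : (R * R) * (R * R) :=
  if h then torus_pt (i%:R + t) 0 else torus_pt i%:R t.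

(** Whichever pair is picked, its arc joins the two elements of [e]. The constant is a default for
    sets that are not edges. *)
Definition edge_arc (e : {set padded_K5 n}) : R -> (R * R) * (R * R) :=
  if [pick hi | e == K5_edge n hi.1 hi.2] is Some hi then arc hi.1 hi.2
  else fun=> torus_pt 0 0.

Lemma normr_intr_lt (p : int) (c : nat) : `|p%:~R : R| < c%:R -> `|p| < c%:Z.
Proof. by rewrite -intr_norm pmulrn ltr_int. Qed.

Lemma intr_notin01 (p : int) (t : R) : 0 < t < 1 -> t <> p%:~R.
Proof.
move=> /andP[t0 t1] tp.
have /normr_intr_lt p1 : `|p%:~R : R| < 1%:R by rewrite -tp gtr0_norm.
by rewrite tp (_ : p = 0) ?ltxx// in t0; lia.
Qed.

Lemma natr_eqDz (i j : nat) (p : int) :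
  i%:R = j%:R + p%:~R :> R -> i%:Z = j%:Z + p.
Proof. by rewrite !pmulrn -intrD => /intr_inj. Qed.

Lemma ord_eq_dvdz5 (i j : 'I_5) (p : int) :
  i%:R = j%:R + p%:~R :> R -> (5 %| p)%Z -> i = j.
Proof.
move=> /natr_eqDz ijp p5; apply: val_inj.
by case: i j ijp => i i5 [j j5] /= ijp; lia.
Qed.

Lemma invSS_itv j : 0 < j.+2%:R^-1 :> R /\ j.+2%:R^-1 < 1 :> R.
Proof. by split; [rewrite invr_gt0|rewrite invf_lt1 ?ltr1n]. Qed.

Lemma intr_eq0_of_0 (q : int) : 0 = 0 + q%:~R :> R -> q = 0.
Proof. by rewrite add0r => /esym/eqP; rewrite intr_eq0 => /eqP. Qed.

Lemma vertex_pt_inj : injective vertex_pt.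
Proof.
have inlr (i : 'I_5) (j : 'I_n) : torus_pt i%:R 0 <> vertex_pt (inr j).
  move=> /torus_pt_eqP[p [q [_ + _]]]; have [] := invSS_itv j.
  move: (_^-1) => s s0 s1 sq.
  by apply: (@intr_notin01 (- q) s); rewrite ?s0 ?s1// mulrNz; lra.
move=> [i|i] [j|j] /=; [|by move/inlr|by move/esym/inlr|].
  move=> /torus_pt_eqP[p [q [ijp /intr_eq0_of_0-> p5]]].
  by congr inl; apply: ord_eq_dvdz5 ijp _; rewrite mulr0 addr0 in p5.
move=> /torus_pt_eqP[p [q [_ sq _]]]; congr inr; apply: val_inj.
(* Two numbers in (0, 1) that differ by an integer are equal. *)
have /normr_intr_lt q1 : `|q%:~R : R| < 1%:R.
  move: sq (invSS_itv i) (invSS_itv j).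
  move: (_^-1) (_^-1) => s s' sq [s0 s1] [s0' s1'].
  by rewrite ltr_norml; apply/andP; split; lra.
move: sq; rewrite (_ : q = 0) ?addr0; last by lia.
by move=> /invr_inj/eqP; rewrite eqr_nat => /eqP[].
Qed.

(** Parameters in [0, 1] differ by at most 1, and the only lattice vector of length at most 1 along
    either axis is 0. *)
Lemma arc_injective h i : {in `[0, 1] &, injective (arc h i)}.
Proof.
move=> t t'; rewrite !in_itv/= => /andP[t0 t1] /andP[t0' t1'].
have small (m : int) : t = t' + m%:~R -> `|m| < 2.
  by move=> tm; apply: normr_intr_lt; rewrite ltr_norml; apply/andP; split; lra.
case: h => /torus_pt_eqP[p [q []]].
  move=> tp /intr_eq0_of_0 q0 p5; have {}tp : t = t' + p%:~R by lra.
  by rewrite tp (_ : p = 0) ?addr0//; have := small _ tp; lia.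
move=> /natr_eqDz ip tq p5.
by rewrite tq (_ : q = 0) ?addr0//; have := small _ tq; lia.
Qed.

(** An interior point of an arc has exactly one integer coordinate, whereas vertices of K5 have two
    and isolated vertices none. *)
Lemma arc_vertex_pt h i t x : 0 < t < 1 -> arc h i t <> vertex_pt x.
Proof.
move=> t01; case: h; case: x => j /torus_pt_eqP[p [q []]].
- move=> tp _ _; apply: (@intr_notin01 (j%:Z + p - i%:Z) t t01).
  by rewrite !(intrD, mulrNz) -!pmulrn; lra.
- move=> _ + _; have [] := invSS_itv j; move: (_^-1) => s s0 s1 sq.
  by apply: (@intr_notin01 (- q) s); rewrite ?s0 ?s1// mulrNz; lra.
- by move=> _ tq _; apply: (@intr_notin01 q t t01); lra.
- move=> ip _ _; apply: (@intr_notin01 (i%:Z - p) (1 / 2)); first by lra.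
  by rewrite !(intrD, mulrNz) -!pmulrn; lra.
Qed.

(** The direction is determined by which coordinate is an integer. For parallel arcs, [t] and [t']
    differ by an integer less than 1 in absolute value, hence by 0, so the starting vertices are
    congruent modulo 5. *)
Lemma arc_disjoint h i t h' i' t' : 0 < t < 1 -> 0 < t' < 1 ->
  arc h i t = arc h' i' t' -> h = h' /\ i = i'.
Proof.
move=> t01 t01'; have /andP[t0 t1] := t01; have /andP[t0' t1'] := t01'.
case: h; case: h' => /torus_pt_eqP[p [q []]].
- move=> tp /intr_eq0_of_0 q0 p5.
  have /normr_intr_lt tt : `|(p + i'%:Z - i%:Z)%:~R : R| < 1%:R.
    rewrite !(intrD, mulrNz) -!pmulrn.
    by rewrite ltr_norml; apply/andP; split; lra.
  split=> //; apply: (@ord_eq_dvdz5 _ _ p); last by lia.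
  rewrite !pmulrn -intrD; congr (_%:~R); lia.
- by move=> _ tq _; case: (@intr_notin01 (- q) t' t01'); rewrite mulrNz; lra.
- by move=> _ tq _; case: (@intr_notin01 q t t01); lra.
- move=> ip tq p5; split=> //; apply: ord_eq_dvdz5 ip _.
  have /normr_intr_lt q1 : `|q%:~R : R| < 1%:R.
    by rewrite ltr_norml; apply/andP; split; lra.
  by move: p5; rewrite (_ : q = 0) ?mulr0 ?addr0//; lia.
Qed.

Lemma arc0 h i : arc h i 0 = vertex_pt (inl i).
Proof. by case: h; rewrite /arc ?addr0. Qed.

(** A vertical arc ends at (i, 1), which is the class of (i + 2, 0) because (-2, 1) lies in the
    lattice. The first component of each witness also corrects for the reduction modulo 5 in
    ['I_5]. *)
Lemma arc1 h i : arc h i 1 = vertex_pt (inl (if h then i + 1 else i + 2)).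
Proof.
case: h; apply/torus_pt_eqP.
  exists (i%:Z + 1 - Posz (nat_of_ord (i + 1)%R)), 0; split.
  - by rewrite !(intrD, mulrNz) -!pmulrn; lra.
  - by rewrite addr0.
  - by case: i => [[|[|[|[|[|?]]]]]].
exists (i%:Z - Posz (nat_of_ord (i + 2)%R)), 1; split.
- by rewrite !(intrD, mulrNz) -!pmulrn; lra.
- by rewrite add0r.
- by case: i => [[|[|[|[|[|?]]]]]].
Qed.

Lemma continuous_arc h i : continuous (arc h i).
Proof.
case: h.
  apply: (@continuous_torus_pt _ (fun t => i%:R + t) (fun=> 0)) => t.
    by apply: cvgD; [exact: cst_continuous|exact: cvg_id].
  exact: cst_continuous.
apply: (@continuous_torus_pt _ (fun=> i%:R) id) => t.
  exact: cst_continuous.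
exact: cvg_id.
Qed.

Lemma edge_arcP e : e \in edges (padded_K5 n) ->
  exists h i, e = K5_edge n h i /\ edge_arc e = arc h i.
Proof.
move=> /padded_K5_edgeP[h [i ehi]]; rewrite /edge_arc.
case: pickP => [[h' i'] /eqP -> /=|/(_ (h, i))]; last by rewrite ehi eqxx.
by exists h', i'.
Qed.

Lemma padded_K5_toroidal : toroidal R (padded_K5 n).
Proof.
exists vertex_pt, edge_arc; split.
- exact: vertex_pt_inj.
- by case=> i; exact: torus_pt_torus.
- move=> e /edge_arcP[h [i [-> ->]]]; split.
  + exact/continuous_subspaceT/continuous_arc.
  + by move=> t t' /set_mem t01 /set_mem t01'; exact: arc_injective.
  + by move=> _ [t _ <-]; rewrite /arc; case: h; exact: torus_pt_torus.
  + rewrite arc0 arc1; apply/seteqP; split=> y /=.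
      case=> ->; first by exists (inl i); rewrite //= !inE eqxx.
      exists (inl (if h then i + 1 else i + 2)) => //=.
      by rewrite !inE eqxx orbT.
    by case=> x /=; rewrite !inE => /orP[]/eqP-> <-; [left|right].
  + apply/seteqP; split=> // y [[t t01 <-] [x _ /esym]].
    by apply: arc_vertex_pt; rewrite /= in_itv in t01.
- move=> e e' /edge_arcP[h [i [-> ->]]] /edge_arcP[h' [i' [-> ->]]] ee'.
  apply/seteqP; split=> // y [[t t01 <-] [t' t01' /esym]].
  rewrite /= !in_itv in t01 t01'.
  by move=> /(arc_disjoint t01 t01')[hh ii]; rewrite hh ii eqxx in ee'.
Qed.

End Drawing.

Theorem theorem3 (R : realType) (k : nat) (hk : (6 <= k)%N) :
  exists G : nat -> sgraph,
    (forall n : nat,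
      [/\ toroidal R (G n),
          (forall l : nat, (6 <= l)%N -> (l <= k)%N -> ~ has_cycle (G n) l) &
          chromatic_number (G n) = 5%N]) /\
    (forall m n : nat, m <> n -> ~ graph_iso (G m) (G n)).
Proof.
exists padded_K5; split=> [n|m n mn [f [fbij _]]].
  split; first exact: padded_K5_toroidal.
    by move=> l l6 _; exact: padded_K5_no_long_cycle.
  exact: padded_K5_chromatic_number.
(* The vertex count [5 + n] determines [n]. *)
by have := bij_eq_card fbij; rewrite !card_padded_K5 => /addnI.
Qed.
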